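(* Let $E$ be a unital $C^*$-algebra, $1\in B\subset E$ a $C^*$-subalgebra and $Y=Y^*\in E$, such that $\mathcal{RA}(Y;B)$ is dense in $E$ and carries a GDQ ring structure with comultiplication $\partial$ satisfying $\partial B=0$ and $\partial Y=1\otimes1$. For $\varphi\in E'$: (i) $U(\varphi^* )=(U(\varphi))^*$. (ii) $U(\varphi)^*=U(\varphi)$ if and only if $\varphi=\varphi^*$. (iii) $\varphi\ge0$ if and only if $-U(\varphi)\ge0$ in the sense of dual positivity in $A(\rho(Y;B))$.
   Context: $\mathfrak{M}_n(E)=\mathfrak{M}_n\otimes E$ is the algebra of $n\times n$ matrices over $E$, and $Y\otimes I_n$ is the diagonal matrix with diagonal entries $Y$. The $n$-th $B$-resolvent set of $Y$ is $\rho_n(Y;B)=\{b\in\mathfrak{M}_n(B): Y\otimes I_n-b\text{ is invertible in }\mathfrak{M}_n(E)\}$, $\rho(Y;B)=(\rho_n(Y;B))_{n\ge1}$, and the $n$-th $B$-resolvent is $R_n(Y;B)(b)=(b-Y\otimes I_n)^{-1}$ for $b\in\rho_n(Y;B)$. Since $Y=Y^*$, $\rho_n(Y;B)$ is closed under $b\mapsto b^*$. $\mathcal{RA}(Y;B)$ is the subalgebra of $E$ generated by $B$, $Y$ and all the matrix entries of the $R_n(Y;B)(b)$, $n\ge1$, $b\in\rho_n(Y;B)$. A GDQ ring structure on an algebra $A$ (multiplication $\mu$) is a linear map $\partial:A\to A\otimes A$ (algebraic tensor product) which is coassociative, $(\partial\otimes\mathrm{id})\circ\partial=(\mathrm{id}\otimes\partial)\circ\partial$,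 and a derivation, $\partial\circ\mu=(\mathrm{id}\otimes\mu)\circ(\partial\otimes\mathrm{id})+(\mu\otimes\mathrm{id})\circ(\mathrm{id}\otimes\partial)$. $E'$ is the dual of the Banach space $E$; for $\varphi\in E'$, $\varphi^*(a)=\overline{\varphi(a^* )}$, and $\varphi\ge0$ means $\varphi$ is a positive functional. $U(\varphi)=(U_n(\varphi))_{n\ge1}$ with $U_n(\varphi):\rho_n(Y;B)\to\mathfrak{M}_n$, $U_n(\varphi)(b)=(\varphi\otimes\mathrm{id}_{\mathfrak{M}_n})(R_n(Y;B)(b))$ ($\varphi$ applied to each matrix entry). $A(\rho(Y;B))$ is the algebra of sequences $f=(f_n)_{n\ge1}$ of analytic functions $f_n:\rho_n(Y;B)\to\mathfrak{M}_n$ with $f_{m+n}(b'\oplus b'')=f_m(b')\oplus f_n(b'')$ and $f_n((S\otimes1)b(S\otimes1)^{-1})=Sf_n(b)S^{-1}$ for $S\in GL(n;\mathbb{C})$; $U(\varphi)$ belongs to it. The involution is $f^*=(f_n^* )_{n\ge1}$, $f_n^*(b)=(f_n(b^* ))^*$. For $f\in A(\rho(Y;B))$ and $b'\in\rho_m(Y;B)$, $b''\in\rho_n(Y;B)$, $(\nabla_{m,n}f_{m+n})(b',b'')$ is the linear map $\mathfrak{M}_{m,n}\to\mathfrak{M}_{m,n}$ (on $m\times n$ complex matrices) taking $h$ to $h'$, where $h'$ is the upper right $m\times n$ block of $\frac{d}{d\varepsilon}f_{m+n}\left(\begin{pmatrix}b'&\varepsilon h\otimes1\\0&b''\end{pmatrix}\right)\Big|_{\varepsilon=0}$.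 The element $f$ is dual positive (written $f\ge0$) if $f=f^*$ and for every $n\ge1$ and $b\in\rho_n(Y;B)$ the map $(\nabla_{n,n}f_{2n})(b,b^* ):\mathfrak{M}_n\to\mathfrak{M}_n$ is positive (maps positive semidefinite matrices to positive semidefinite matrices). *)

(* Defs.v *)
From HB Require Import structures.
From mathcomp Require Import all_boot all_order all_algebra.
From mathcomp Require Import generic_quotient.
From mathcomp Require Import all_classical all_reals all_analysis complex.
Set Implicit Arguments.
Unset Strict Implicit.
Unset Printing Implicit Defensive.
Import Order.TTheory GRing.Theory Num.Theory.
Import numFieldNormedType.Exports.
Local Open Scope classical_set_scope.
Local Open Scope quotient_scope.
Local Open Scope sesquilinear_scope.
Local Open Scope ring_scope.

(* Everything below is written over a numClosedFieldType C, which the theorem  *)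
(* instantiates with the complex numbers R[i], R : realType.                   *)

(* The algebraic tensor product: formal finite sums of pairs (u, v), modulo    *)
(* the congruence generated by bilinearity; tensU below is its universal       *)
(* property.                                                                   *)
Section Tensor.
Variables (K : fieldType) (U V : lmodType K).

Inductive tens_rel : seq (U * V) -> seq (U * V) -> Prop :=
| tens_rel_refl s : tens_rel s s
| tens_rel_sym s t : tens_rel s t -> tens_rel t s
| tens_rel_trans s t r : tens_rel s t -> tens_rel t r -> tens_rel s r
| tens_rel_cat s s' t t' :
    tens_rel s s' -> tens_rel t t' -> tens_rel (s ++ t) (s' ++ t')
| tens_rel_catC s t : tens_rel (s ++ t) (t ++ s)
| tens_rel_0 v : tens_rel [:: (0, v)] [::]
| tens_rel_Dl u u' v : tens_rel [:: (u + u', v)] [:: (u, v); (u', v)]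
| tens_rel_Dr u v v' : tens_rel [:: (u, v + v')] [:: (u, v); (u, v')]
| tens_rel_Z a u v : tens_rel [:: (a *: u, v)] [:: (u, a *: v)].

Definition tens_relb (s t : seq (U * V)) : bool := `[< tens_rel s t >].

Lemma tens_relb_refl : reflexive tens_relb.
Proof. by move=> s; apply/asboolP; exact: tens_rel_refl. Qed.

Lemma tens_relb_sym : symmetric tens_relb.
Proof. by move=> s t; apply/asboolP/asboolP; exact: tens_rel_sym. Qed.

Lemma tens_relb_trans : transitive tens_relb.
Proof.
move=> t s r /asboolP st /asboolP tr; apply/asboolP.
exact: tens_rel_trans st tr.
Qed.

Canonical tens_equiv :=
  EquivRel tens_relb tens_relb_refl tens_relb_sym tens_relb_trans.

Definition tensor : Type := {eq_quot tens_equiv}.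
HB.instance Definition _ := Choice.on tensor.
HB.instance Definition _ := EqQuotient.on tensor.

Implicit Types t : tensor.

Definition tens_class (s : seq (U * V)) : tensor := \pi_tensor s.

Lemma tensW (P : tensor -> Prop) : (forall s, P (tens_class s)) -> forall t, P t.
Proof. by move=> h; elim/quotW; exact: h. Qed.

Lemma tensorP (s s' : seq (U * V)) :
  (tens_class s = tens_class s') <-> tens_rel s s'.
Proof.
split=> [/eqquotP/asboolP //|h]; apply/eqquotP; exact/asboolP.
Qed.

Lemma tens_rel_repr (s : seq (U * V)) : tens_rel (repr (tens_class s)) s.
Proof. by apply/tensorP; rewrite /tens_class reprK. Qed.

Definition tens (u : U) (v : V) : tensor := tens_class [:: (u, v)].

Definition tens_add (t t' : tensor) : tensor := tens_class (repr t ++ repr t').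
Definition tens_scale_seq (a : K) (s : seq (U * V)) : seq (U * V) :=
  [seq (a *: p.1, p.2) | p <- s].
Definition tens_scale (a : K) (t : tensor) : tensor :=
  tens_class (tens_scale_seq a (repr t)).
Definition tens_opp (t : tensor) : tensor := tens_scale (-1) t.

Lemma tens_addE s s' :
  tens_add (tens_class s) (tens_class s') = tens_class (s ++ s').
Proof. by apply/tensorP/tens_rel_cat; exact: tens_rel_repr. Qed.

Lemma tens_scale_rel a s s' : tens_rel s s' ->
  tens_rel (tens_scale_seq a s) (tens_scale_seq a s').
Proof.
elim=> {s s'} [s|s t _ h|s t r _ h _ h'|s s' t t' _ h _ h'|s t|v|u u' v|u v v'
  |b u v].
- exact: tens_rel_refl.
- exact: tens_rel_sym.
- exact: tens_rel_trans h h'.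
- by rewrite /tens_scale_seq !map_cat; exact: tens_rel_cat.
- by rewrite /tens_scale_seq !map_cat; exact: tens_rel_catC.
- by rewrite /= scaler0; exact: tens_rel_0.
- by rewrite /= scalerDr; exact: tens_rel_Dl.
- exact: tens_rel_Dr.
- by rewrite /= scalerA mulrC -scalerA; exact: tens_rel_Z.
Qed.

Lemma tens_scaleE a s :
  tens_scale a (tens_class s) = tens_class (tens_scale_seq a s).
Proof. apply/tensorP/tens_scale_rel; exact: tens_rel_repr. Qed.

Lemma tens_addA : associative tens_add.
Proof.
by elim/tensW=> s; elim/tensW=> t; elim/tensW=> r; rewrite !tens_addE catA.
Qed.

Lemma tens_addC : commutative tens_add.
Proof.
elim/tensW=> s; elim/tensW=> t; rewrite !tens_addE.
by apply/tensorP; exact: tens_rel_catC.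
Qed.

Lemma tens_add0 : left_id (tens_class [::]) tens_add.
Proof. by elim/tensW=> s; rewrite tens_addE. Qed.

Lemma tens_scaleD s a b :
  tens_rel (tens_scale_seq (a + b) s) (tens_scale_seq a s ++ tens_scale_seq b s).
Proof.
elim: s => [|[u v] s ih] /=; first exact: tens_rel_refl.
rewrite scalerDl.
apply: (tens_rel_trans (tens_rel_cat (tens_rel_Dl (a *: u) (b *: u) v) ih)).
set A := tens_scale_seq a s; set B := tens_scale_seq b s.
change (tens_rel ([:: (a *: u, v)] ++ [:: (b *: u, v)] ++ (A ++ B))
                 ([:: (a *: u, v)] ++ (A ++ ([:: (b *: u, v)] ++ B)))).
apply: tens_rel_cat; first exact: tens_rel_refl.
rewrite !catA; apply: tens_rel_cat; last exact: tens_rel_refl.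
exact: tens_rel_catC.
Qed.

Lemma tens_scale0 s : tens_rel (tens_scale_seq 0 s) [::].
Proof.
elim: s => [|[u v] s ih] /=; first exact: tens_rel_refl.
rewrite scale0r -cat1s -[X in tens_rel _ X]cats0.
exact: (tens_rel_cat (tens_rel_0 v) ih).
Qed.

Lemma tens_scale1_seq s : tens_scale_seq 1 s = s.
Proof. by elim: s => [|[u v] s ih] //=; rewrite scale1r ih. Qed.

Lemma tens_addN : left_inverse (tens_class [::]) tens_opp tens_add.
Proof.
elim/tensW=> s; rewrite /tens_opp tens_scaleE tens_addE; apply/tensorP.
rewrite -[s in _ ++ s]tens_scale1_seq.
apply: tens_rel_trans (tens_rel_sym (tens_scaleD s (-1) 1)) _.
by rewrite addNr; exact: tens_scale0.
Qed.

HB.instance Definition _ :=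
  GRing.isZmodule.Build tensor tens_addA tens_addC tens_add0 tens_addN.

Lemma tensorD s s' : tens_class s + tens_class s' = tens_class (s ++ s').
Proof. exact: tens_addE. Qed.

Lemma tens_scaleA a b t : tens_scale a (tens_scale b t) = tens_scale (a * b) t.
Proof.
elim/tensW: t => s; rewrite !tens_scaleE /tens_scale_seq -map_comp.
by congr (tens_class _); apply: eq_map => -[u v] /=; rewrite scalerA.
Qed.

Lemma tens_scale1 : left_id 1 tens_scale.
Proof. by elim/tensW=> s; rewrite tens_scaleE tens_scale1_seq. Qed.

Lemma tens_scaleDr : right_distributive tens_scale +%R.
Proof.
move=> a; elim/tensW=> s; elim/tensW=> t.
by rewrite tensorD !tens_scaleE tensorD /tens_scale_seq map_cat.
Qed.

Lemma tens_scaleDl t : {morph tens_scale^~ t : a b / a + b}.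
Proof.
move=> a b; elim/tensW: t => s; rewrite !tens_scaleE tensorD.
by apply/tensorP; exact: tens_scaleD.
Qed.

HB.instance Definition _ := GRing.Zmodule_isLmodule.Build K tensor
  tens_scaleA tens_scale1 tens_scaleDr tens_scaleDl.

Lemma tensorZ a s :
  a *: tens_class s = tens_class (tens_scale_seq a s) :> tensor.
Proof. exact: tens_scaleE. Qed.

(* The linear map induced on the tensor product by a bilinear map f.           *)
Definition tens_lift (W : lmodType K) (f : U -> V -> W) (t : tensor) : W :=
  \sum_(p <- repr t) f p.1 p.2.

Definition bilinear_map (W : lmodType K) (f : U -> V -> W) : Prop :=
  (forall v, linear (f^~ v)) /\ (forall u, linear (f u)).

Lemma tens_bilinear : bilinear_map tens.
Proof.
have tZ a u v : tens (a *: u) v = a *: tens u v by rewrite /tens tensorZ.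
split=> [v a u u'|u a v v'].
- by rewrite -tZ /tens tensorD; apply/tensorP; exact: tens_rel_Dl.
- rewrite -tZ /tens tensorD; apply/tensorP.
  apply: tens_rel_trans (tens_rel_Dr _ _ _) _.
  apply: (@tens_rel_cat [:: (u, a *: v)] [:: (a *: u, v)] [:: _] [:: _]).
    exact/tens_rel_sym/tens_rel_Z.
  exact: tens_rel_refl.
Qed.

Lemma tens_liftE (W : lmodType K) (f : U -> V -> W) (s : seq (U * V)) :
  bilinear_map f -> tens_lift f (tens_class s) = \sum_(p <- s) f p.1 p.2.
Proof.
move=> [fl fr]; rewrite /tens_lift.
have f0v v : f 0 v = 0.
  by have := fl v (-1) 0 0; rewrite scaler0 addr0 scaleN1r addNr.
have fu0 u : f u 0 = 0.
  by have := fr u (-1) 0 0; rewrite scaler0 addr0 scaleN1r addNr.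
have key s1 s2 : tens_rel s1 s2 ->
    \sum_(p <- s1) f p.1 p.2 = \sum_(p <- s2) f p.1 p.2.
  elim=> {s1 s2} [//|s1 t _ -> //|s1 t r _ -> _ -> //|s1 s' t t' _ h _ h'
    |s1 t|v|u u' v|u v v'|b u v].
  - by rewrite !big_cat /= h h'.
  - by rewrite !big_cat /= addrC.
  - by rewrite big_seq1 big_nil.
  - rewrite big_seq1 big_cons big_seq1 /=.
    by have := fl v 1 u u'; rewrite !scale1r.
  - rewrite big_seq1 big_cons big_seq1 /=.
    by have := fr u 1 v v'; rewrite !scale1r.
  - rewrite !big_seq1 /=; have := fl v b u 0; rewrite !addr0 f0v addr0 => ->.
    by have := fr u b v 0; rewrite !addr0 fu0 addr0 => ->.
exact: key (tens_rel_repr s).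
Qed.

Lemma tensU (W : lmodType K) (f : U -> V -> W) : bilinear_map f ->
  [/\ linear (tens_lift f), forall u v, tens_lift f (tens u v) = f u v
   & forall g : tensor -> W, linear g -> (forall u v, g (tens u v) = f u v) ->
     g =1 tens_lift f].
Proof.
move=> bf; split=> [a|u v|g lg gE].
- elim/tensW=> s; elim/tensW=> t.
  rewrite tensorZ tensorD !tens_liftE // big_cat /=; congr (_ + _).
  rewrite big_map scaler_sumr; apply: eq_bigr => -[u v] _ /=.
  have [fl _] := bf; have f0v : f 0 v = 0.
    by have := fl v (-1) 0 0; rewrite scaler0 addr0 scaleN1r addNr.
  by have := fl v a u 0; rewrite !addr0 f0v addr0.
- by rewrite tens_liftE // big_seq1.
- have g0 : g 0 = 0.
    by have := lg (-1) 0 0; rewrite scaler0 addr0 scaleN1r addNr.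
  have gD x y : g (x + y) = g x + g y by have := lg 1 x y; rewrite !scale1r.
  elim/tensW; elim=> [|[u v] s ih].
    by rewrite tens_liftE // big_nil -[RHS]g0.
  rewrite tens_liftE // big_cons -tens_liftE // -ih -gE -gD.
  by rewrite /tens tensorD.
Qed.

End Tensor.

Section TensorMaps.
Variable K : fieldType.

Definition tens_map (U V U' V' : lmodType K) (f : U -> U') (g : V -> V') :
    tensor U V -> tensor U' V' :=
  tens_lift (fun u v => tens (f u) (g v)).

Definition tens_assoc (U V W : lmodType K) :
    tensor (tensor U V) W -> tensor U (tensor V W) :=
  tens_lift (fun t w => tens_lift (fun u v => tens u (tens v w)) t).

Definition tens_assocV (U V W : lmodType K) :
    tensor U (tensor V W) -> tensor (tensor U V) W :=
  tens_lift (fun u t => tens_lift (fun v w => tens (tens u v) w) t).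

Definition tens_mul (A : algType K) : tensor A A -> A :=
  tens_lift (fun a b : A => a * b).

Definition GDQ_ring (A : algType K) (d : {linear A -> tensor A A}) : Prop :=
  (forall a, tens_assoc (tens_map d id (d a)) = tens_map id d (d a)) /\
  (forall t, d (tens_mul t) =
     tens_map id (@tens_mul A) (tens_assoc (tens_map d id t)) +
     tens_map (@tens_mul A) id (tens_assocV (tens_map id d t))).

End TensorMaps.

Section GeneratedSubalgebra.
Variables (K : fieldType) (A : algType K) (S : set A).

Definition subalg_gen : set A :=
  smallest [set D : set A | GRing.subalg_closed (mem D)] S.

Lemma subalg_gen_closed : GRing.subalg_closed (mem subalg_gen).
Proof.
split.
- by apply/mem_set => D [[D1 _ _] _]; exact/set_mem.
- move=> a x y /set_mem xS /set_mem yS; apply/mem_set => D hD.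
  have [[_ Dl _] _] := hD; apply/set_mem/Dl; apply/mem_set; first exact: xS.
  exact: yS.
- move=> x y /set_mem xS /set_mem yS; apply/mem_set => D hD.
  have [[_ _ Dm] _] := hD; apply/set_mem/Dm; apply/mem_set; first exact: xS.
  exact: yS.
Qed.

Definition subalg_gen_pred : {pred A} := fun x => x \in subalg_gen.

HB.instance Definition _ :=
  GRing.isSubalgClosed.Build K A subalg_gen_pred subalg_gen_closed.

Definition gen_alg : Type := {x : A | x \in subalg_gen_pred}.
HB.instance Definition _ := SubChoice.on gen_alg.
HB.instance Definition _ := [SubChoice_isSubAlgebra of gen_alg by <:].

End GeneratedSubalgebra.

(* Normed algebras and C*-algebras. The normed-module structure is carried by  *)
(* the convertible copy `banach E`, since the hierarchy has no join of rings    *)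
(* and normed Z-modules besides the number domains.                            *)
HB.mixin Record Algebra_isNormed (C : numClosedFieldType) E
    of GRing.Algebra C E := {
  anorm : E -> C ;
  anormD_le : forall x y : E, anorm (x + y) <= anorm x + anorm y ;
  anormZ : forall (a : C) (x : E), anorm (a *: x) = `|a| * anorm x ;
  anorm0_eq0 : forall x : E, anorm x = 0 -> x = 0 ;
  anormM_le : forall x y : E, anorm (x * y) <= anorm x * anorm y
}.

#[short(type="normedAlgType")]
HB.structure Definition NormedAlgebra (C : numClosedFieldType) :=
  {E of GRing.Algebra C E & Algebra_isNormed C E}.

Definition banach (C : numClosedFieldType) (E : normedAlgType C) : Type := E.
HB.instance Definition _ (C : numClosedFieldType) (E : normedAlgType C) :=
  GRing.Lmodule.on (banach E).
HB.instance Definition _ (C : numClosedFieldType) (E : normedAlgType C) :=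
  Lmodule_isNormed.Build C (banach E)
    (@anormD_le C E) (@anormZ C E) (@anorm0_eq0 C E).

HB.mixin Record NormedAlgebra_isCStar (C : numClosedFieldType) E
    of NormedAlgebra C E := {
  banach_complete : forall F : set_system (banach E),
    ProperFilter F -> cauchy F -> cvg F ;
  star : E -> E ;
  starK : involutive star ;
  star_semilinear : forall (a : C) (x y : E),
    star (a *: x + y) = a^* *: star x + star y ;
  starM : forall x y : E, star (x * y) = star y * star x ;
  anorm_starM : forall x : E, anorm (star x * x) = anorm x ^+ 2
}.

#[short(type="cstarAlgType")]
HB.structure Definition CStarAlgebra (C : numClosedFieldType) :=
  {E of NormedAlgebra C E & NormedAlgebra_isCStar C E}.

HB.instance Definition _ (C : numClosedFieldType) (E : cstarAlgType C) :=
  Uniform_isComplete.Build (banach E) (@banach_complete C E).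

Section Resolvents.
Variables (C : numClosedFieldType) (E : cstarAlgType C).
Implicit Types (B : set E) (Y : E).

Definition unital_cstar_subalg B : Prop :=
  [/\ GRing.subalg_closed (mem B), closed (B : set (banach E)) & forall x, B x -> B (star x)].

Definition mxstar m n (b : 'M[E]_(m, n)) : 'M[E]_(n, m) := map_mx star b^T.

(* The amplification h (x) 1 of a complex matrix h.                            *)
Definition ampl m n (h : 'M[C]_(m, n)) : 'M[E]_(m, n) :=
  map_mx (fun z : C => z%:A) h.

Definition mx_over B m n : set 'M[E]_(m, n) := [set b | forall i j, B (b i j)].

Definition mx_is_inv n (x y : 'M[E]_n) : Prop :=
  x *m y = 1%:M /\ y *m x = 1%:M.

(* 0 if x is not invertible; mathcomp's invmx needs a commutative ring.        *)
Definition mxinv n (x : 'M[E]_n) : 'M[E]_n := xget 0 [set y | mx_is_inv x y].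

Definition rho B Y n : set 'M[E]_n :=
  [set b | mx_over B b /\ exists y, mx_is_inv (Y%:M - b) y].

Definition resolvent Y n (b : 'M[E]_n) : 'M[E]_n := mxinv (b - Y%:M).

Definition RA_gens B Y : set E :=
  B `|` [set Y] `|`
  [set x | exists n (b : 'M[E]_n) i j,
     [/\ (0 < n)%N, rho B Y b & x = resolvent Y b i j]].

Definition RA B Y : set E := subalg_gen (RA_gens B Y).
Definition RA_alg B Y : algType C := gen_alg (RA_gens B Y).

(* Sequences (f_n) of functions rho_n -> M_n are represented by functions      *)
(* defined on all of M_n(E), for all n; only their values on rho_n, n >= 1,    *)
(* are meaningful, see fseq_eq.                                                *)
Definition fseq : Type := forall n, 'M[E]_n -> 'M[C]_n.
Implicit Types f g : fseq.

Definition fseq_eq B Y f g : Prop :=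
  forall n (b : 'M[E]_n), (0 < n)%N -> rho B Y b -> f n b = g n b.

Definition fseq_star f : fseq := fun n b => (f n (mxstar b)) ^t*.

Definition fseq_opp f : fseq := fun n b => - f n b.

(* Entrywise l1 norm; it induces the usual topology of M_n(E).                 *)
Definition mx_l1norm m n (h : 'M[E]_(m, n)) : C := \sum_i \sum_j anorm (h i j).

Definition bounded_multilinear B n k
    (M : ('I_k -> 'M[E]_n) -> 'M[C]_n) : Prop :=
  (forall (h : 'I_k -> 'M[E]_n) (i : 'I_k) (a : C) (x y : 'M[E]_n),
     (forall j, mx_over B (h j)) -> mx_over B x -> mx_over B y ->
     M [eta h with i |-> a%:A *: x + y] =
       a *: M [eta h with i |-> x] + M [eta h with i |-> y]) /\
  (exists c : C, forall h : 'I_k -> 'M[E]_n, (forall j, mx_over B (h j)) ->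
     `|M h| <= c * \prod_j mx_l1norm (h j)).

(* Analyticity on the open subset rho_n of the Banach space M_n(B): near each  *)
(* point f is the sum of a uniformly convergent power series, whose k-th term  *)
(* h |-> P k (h, ..., h) is a continuous k-homogeneous polynomial.             *)
Definition analytic_on_rho B Y n (f : 'M[E]_n -> 'M[C]_n) : Prop :=
  forall b : 'M[E]_n, rho B Y b ->
  exists (r : C) (P : forall k, ('I_k -> 'M[E]_n) -> 'M[C]_n),
  [/\ 0 < r, forall k, bounded_multilinear B (P k) &
      forall e : C, 0 < e -> exists N : nat, forall m : nat, (N <= m)%N ->
      forall h : 'M[E]_n, mx_over B h -> mx_l1norm h < r -> rho B Y (b + h) ->
        `|f (b + h) - \sum_(k < m) P k (fun=> h)| <= e].

(* f belongs to A(rho(Y;B)).                                                   *)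
Definition fully_matricial B Y f : Prop :=
  [/\ forall n, (0 < n)%N -> analytic_on_rho B Y (f n),
      forall m n (b' : 'M[E]_m) (b'' : 'M[E]_n), (0 < m)%N -> (0 < n)%N ->
        rho B Y b' -> rho B Y b'' ->
        f (m + n)%N (block_mx b' 0 0 b'') = block_mx (f m b') 0 0 (f n b'')
    & forall n (b : 'M[E]_n) (S : 'M[C]_n), (0 < n)%N -> rho B Y b ->
        S \in unitmx ->
        f n (ampl S *m b *m ampl (invmx S)) = S *m f n b *m invmx S].

Definition nabla m n (f : fseq) (b' : 'M[E]_m) (b'' : 'M[E]_n)
    (h : 'M[C]_(m, n)) : 'M[C]_(m, n) :=
  ursubmx (derive1 (fun eps : C =>
    f (m + n)%N (block_mx b' (ampl (eps *: h)) 0 b'')) 0).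

Definition psdmx n (h : 'M[C]_n) : Prop :=
  h ^t* = h /\ forall v : 'cV[C]_n, 0 <= (v ^t* *m h *m v) 0 0.

Definition dual_positive B Y f : Prop :=
  [/\ fully_matricial B Y f, fseq_eq B Y f (fseq_star f)
    & forall n (b : 'M[E]_n), (0 < n)%N -> rho B Y b ->
        forall h : 'M[C]_n, psdmx h -> psdmx (nabla f b (mxstar b) h)].

Definition dual_star (phi : E -> C) : E -> C := fun a => (phi (star a))^*.

Definition positive_functional (phi : E -> C) : Prop :=
  forall a : E, 0 <= phi (star a * a).

Definition Utrans Y (phi : E -> C) : fseq :=
  fun n b => map_mx phi (resolvent Y b).

End Resolvents.

(* Main.v *)
(* Let Z be the set of the elements v R_n(b) w with n >= 1, b in rho_n(Y;B), v a
   complex row and w a complex column. Direct sums make Z a linear subspace, and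
   the corner - R(b') X R(b'') of the resolvent of [b' X; 0 b''] shows that Z B Z
   is contained in Z. Since l (l - Y)^-1 tends to 1 as l tends to infinity, the
   closure of Z is an algebra containing B, Y and all resolvent entries, so Z is
   dense in E. Hence U(phi) determines phi, which gives (ii). By the same block
   computation, - nabla U(phi) at the pair b, c = b^* maps h to phi applied to
   the entries of R(b) h R(c), where R(c) = R(b)^*. For h = w w^* the value of the
   corresponding quadratic form at v^* is phi(z z^* ), z = v R(b) w in Z; density
   of Z and the factorization h = k k^* of positive semidefinite matrices give
   (iii). *)
Require Import Defs.
From HB Require Import structures.
From mathcomp Require Import all_boot all_order all_algebra.
From mathcomp Require Import all_classical all_reals all_analysis complex.
Set Implicit Arguments.
Unset Strict Implicit.
Unset Printing Implicit Defensive.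
Import Order.TTheory GRing.Theory Num.Theory.
Import numFieldNormedType.Exports.
Local Open Scope classical_set_scope.
Local Open Scope complex_scope.
Local Open Scope ring_scope.

(** * The involution, the norm and matrices over a C*-algebra *)

Section StarAlgebra.
Variables (C : numClosedFieldType) (E : cstarAlgType C).
Implicit Types x y z : E.

Lemma starD x y : star (x + y) = star x + star y.
Proof. by have := star_semilinear 1 x y; rewrite conjC1 !scale1r. Qed.

Lemma star0 : star (0 : E) = 0.
Proof. by apply: (addrI (star 0)); rewrite -starD !addr0. Qed.

Lemma starZ (a : C) x : star (a *: x) = a^* *: star x.
Proof. by have := star_semilinear a x 0; rewrite !addr0 star0 addr0. Qed.

Lemma starN x : star (- x) = - star x.
Proof. by rewrite -scaleN1r starZ rmorphN1 scaleN1r. Qed.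

Lemma star1 : star (1 : E) = 1.
Proof. by rewrite -[LHS]mulr1 -[X in _ * X](starK 1) -starM mulr1 starK. Qed.

Lemma star_alg (a : C) : star (a%:A : E) = (a^*)%:A.
Proof. by rewrite starZ star1. Qed.

Lemma star_sum I (r : seq I) (P : pred I) (F : I -> E) :
  star (\sum_(i <- r | P i) F i) = \sum_(i <- r | P i) star (F i).
Proof. by apply: big_morph; [exact: starD | exact: star0]. Qed.

Lemma anorm_ge0 x : 0 <= anorm x.
Proof. exact: (normr_ge0 (x : banach E)). Qed.

Lemma anorm0 : anorm (0 : E) = 0.
Proof. exact: (normr0 (banach E)). Qed.

Lemma anormN x : anorm (- x) = anorm x.
Proof. exact: (normrN (x : banach E)). Qed.

Lemma anormB_le x y z : anorm (x - z) <= anorm (x - y) + anorm (y - z).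
Proof. by have := anormD_le (x - y) (y - z); rewrite addrA subrK. Qed.

Lemma anorm_sum_le I (r : seq I) (P : pred I) (F : I -> E) :
  anorm (\sum_(i <- r | P i) F i) <= \sum_(i <- r | P i) anorm (F i).
Proof. exact: (ler_norm_sum r (F : I -> banach E) P). Qed.

Lemma mxstarE m n (A : 'M[E]_(m, n)) i j : mxstar A i j = star (A j i).
Proof. by rewrite !mxE. Qed.

Lemma mxstarM m n p (A : 'M[E]_(m, n)) (A' : 'M[E]_(n, p)) :
  mxstar (A *m A') = mxstar A' *m mxstar A.
Proof.
apply/matrixP => i j; rewrite mxstarE !mxE star_sum.
by apply: eq_bigr => k _; rewrite starM !mxstarE.
Qed.

Lemma mxstarB m n (A A' : 'M[E]_(m, n)) :
  mxstar (A - A') = mxstar A - mxstar A'.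
Proof. by apply/matrixP => i j; rewrite !(mxstarE, mxE) starD starN. Qed.

Lemma mxstar_scalar n x : mxstar (x%:M : 'M[E]_n) = (star x)%:M.
Proof.
apply/matrixP => i j; rewrite mxstarE !mxE eq_sym.
by case: (i == j); rewrite /= ?mulr1n // mulr0n star0.
Qed.

Lemma amplE m n (h : 'M[C]_(m, n)) i j : ampl E h i j = (h i j)%:A.
Proof. by rewrite mxE. Qed.

Lemma amplM m n p (h : 'M[C]_(m, n)) (k : 'M[C]_(n, p)) :
  ampl E (h *m k) = ampl E h *m ampl E k.
Proof. exact: (map_mxM (in_alg E)). Qed.

Lemma ampl1 n : ampl E (1%:M : 'M[C]_n) = 1%:M.
Proof. exact: (map_mx1 (in_alg E)). Qed.

Lemma ampl0 m n : ampl E (0 : 'M[C]_(m, n)) = 0.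
Proof. exact: (map_mx0 (in_alg E)). Qed.

Lemma ampl_row_mx m n1 n2 (h : 'M[C]_(m, n1)) (k : 'M[C]_(m, n2)) :
  ampl E (row_mx h k) = row_mx (ampl E h) (ampl E k).
Proof. exact: map_row_mx. Qed.

Lemma ampl_col_mx m1 m2 n (h : 'M[C]_(m1, n)) (k : 'M[C]_(m2, n)) :
  ampl E (col_mx h k) = col_mx (ampl E h) (ampl E k).
Proof. exact: map_col_mx. Qed.

Lemma mxstar_ampl m n (h : 'M[C]_(m, n)) :
  mxstar (ampl E h) = ampl E (map_mx Num.conj h^T).
Proof. by apply/matrixP => i j; rewrite mxstarE !amplE star_alg !mxE. Qed.

(** The entries of [ampl E h] are scalar multiples of 1, hence central. This is why conjugation by a
    complex matrix fixes [Y%:M]. *)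
Lemma scalar_ampl_comm m n (y : E) (h : 'M[C]_(m, n)) :
  y%:M *m ampl E h = ampl E h *m y%:M.
Proof.
apply/matrixP => i j; rewrite mul_scalar_mx !mxE (bigD1 j) //= big1 => [|k kj].
  by rewrite !mxE eqxx addr0 mulr1n -scalerAr -scalerAl mul1r mulr1.
by rewrite !mxE (negPf kj) mulr0n mulr0.
Qed.

Lemma mx_is_inv_uniq n (x y y' : 'M[E]_n) :
  mx_is_inv x y -> mx_is_inv x y' -> y = y'.
Proof. by move=> [_ yx] [xy' _]; rewrite -[y]mulmx1 -xy' mulmxA yx mul1mx. Qed.

(** Two-sided inverses are unique, so the choice made by [xget] is forced: exhibiting an inverse
    computes [mxinv], and hence any resolvent. *)
Lemma mxinv_eq n (x y : 'M[E]_n) : mx_is_inv x y -> mxinv x = y.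
Proof.
move=> xy; apply: mx_is_inv_uniq (xy).
by apply: (@xgetPex _ 0 [set z | mx_is_inv x z]); exists y.
Qed.

End StarAlgebra.

(** * Resolvents of block triangular, similar and adjoint matrices *)

Section ResolventAlgebra.
Variables (C : numClosedFieldType) (E : cstarAlgType C) (B : set E) (Y : E).
Hypothesis hB : unital_cstar_subalg B.

Lemma cstar_subalg_alg (a : C) : B a%:A.
Proof.
have [[B1 Blin _] _ _] := hB; apply/set_mem.
have B0 : 0 \in B.
  by move: (Blin (-1) 1 1 B1 B1); rewrite scaleN1r addNr.
by rewrite -[_%:A]addr0; exact: Blin.
Qed.

Lemma cstar_subalg0 : B 0.
Proof. by rewrite -[0](scale0r 1); exact: cstar_subalg_alg. Qed.

Lemma cstar_subalgD x y : B x -> B y -> B (x + y).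
Proof.
have [[_ Blin _] _ _] := hB => Bx By; apply/set_mem.
by rewrite -[x]scale1r; apply: Blin; apply/mem_set.
Qed.

Lemma cstar_subalgM x y : B x -> B y -> B (x * y).
Proof.
have [[_ _ BM] _ _] := hB => Bx By; apply/set_mem.
by apply: BM; apply/mem_set.
Qed.

Lemma mx_over_ampl m n (h : 'M[C]_(m, n)) : mx_over B (ampl E h).
Proof. by move=> i j; rewrite amplE; exact: cstar_subalg_alg. Qed.

Lemma mx_overM m n p (x : 'M[E]_(m, n)) (y : 'M[E]_(n, p)) :
  mx_over B x -> mx_over B y -> mx_over B (x *m y).
Proof.
move=> Bx By i j; rewrite mxE; apply: big_ind => [||k _].
- exact: cstar_subalg0.
- exact: cstar_subalgD.
- exact: cstar_subalgM.
Qed.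

Lemma mx_over_block m n (b' : 'M[E]_m) x y (b'' : 'M[E]_n) :
  mx_over B b' -> mx_over B x -> mx_over B y -> mx_over B b'' ->
  mx_over B (block_mx b' x y b'').
Proof.
move=> h1 h2 h3 h4 i j; rewrite -(fintype.splitK i) -(fintype.splitK j).
by case: (fintype.split i) => k; case: (fintype.split j) => l /=;
  rewrite ?(block_mxEul, block_mxEur, block_mxEdl, block_mxEdr).
Qed.

Lemma mx_over0 m n : mx_over B (0 : 'M[E]_(m, n)).
Proof. by move=> i j; rewrite mxE; exact: cstar_subalg0. Qed.

(** Bridges the two sign conventions: [rho] inverts [Y - b], whereas the resolvent inverts
    [b - Y]. *)
Lemma rhoI n (b y : 'M[E]_n) :
  mx_over B b -> mx_is_inv (b - Y%:M) y -> rho B Y b.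
Proof.
move=> Bb [h1 h2]; split => //; exists (- y).
by split; rewrite -opprB (mulNmx, mulmxN) (mulNmx, mulmxN) opprK.
Qed.

Lemma resolventP n (b : 'M[E]_n) :
  rho B Y b -> mx_is_inv (b - Y%:M) (resolvent Y b).
Proof.
move=> [_ [y [h1 h2]]].
have yP : mx_is_inv (b - Y%:M) (- y).
  by split; rewrite -opprB (mulNmx, mulmxN) (mulNmx, mulmxN) opprK.
by rewrite /resolvent (mxinv_eq yP).
Qed.

(** Back substitution forces the corner [- R' x R'']; both products with the candidate inverse are
    then checked blockwise. *)
Lemma resolvent_block n1 n2 (b' : 'M[E]_n1) (b'' : 'M[E]_n2) x :
  rho B Y b' -> rho B Y b'' -> mx_over B x ->
  rho B Y (block_mx b' x 0 b'') /\
  resolvent Y (block_mx b' x 0 b'') =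
    block_mx (resolvent Y b') (- (resolvent Y b' *m x *m resolvent Y b''))
      0 (resolvent Y b'').
Proof.
move=> rb' rb'' Bx.
have [h1 h2] := resolventP rb'; have [h3 h4] := resolventP rb''.
set r' := resolvent Y b' in h1 h2 *; set r'' := resolvent Y b'' in h3 h4 *.
have inv : mx_is_inv (block_mx b' x 0 b'' - Y%:M)
    (block_mx r' (- (r' *m x *m r'')) 0 r'').
  rewrite scalar_mx_block opp_block_mx add_block_mx oppr0 !addr0.
  split; rewrite mulmx_block ?(mulmxN, mulNmx);
    rewrite !(mulmx0, mul0mx, oppr0, addr0, add0r).
    by rewrite !mulmxA h1 mul1mx h3 addNr -scalar_mx_block.
  by rewrite -!mulmxA h4 h2 mulmx1 subrr -scalar_mx_block.
split; last exact: mxinv_eq.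
apply: rhoI inv; apply: mx_over_block => //; last by case: rb''.
  by case: rb'.
exact: mx_over0.
Qed.

Lemma resolvent_diag n1 n2 (b' : 'M[E]_n1) (b'' : 'M[E]_n2) :
  rho B Y b' -> rho B Y b'' ->
  rho B Y (block_mx b' 0 0 b'') /\
  resolvent Y (block_mx b' 0 0 b'') =
    block_mx (resolvent Y b') 0 0 (resolvent Y b'').
Proof.
move=> rb' rb''; have := resolvent_block rb' rb'' (@mx_over0 n1 n2).
by rewrite mulmx0 mul0mx oppr0.
Qed.

Lemma resolvent_similar n (b : 'M[E]_n) (S : 'M[C]_n) :
  rho B Y b -> S \in unitmx ->
  resolvent Y (ampl E S *m b *m ampl E (invmx S)) =
    ampl E S *m resolvent Y b *m ampl E (invmx S).
Proof.
move=> rb uS; have [h1 h2] := resolventP rb; apply: mxinv_eq.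
have SV : ampl E S *m ampl E (invmx S) = 1%:M by rewrite -amplM mulmxV // ampl1.
have VS : ampl E (invmx S) *m ampl E S = 1%:M by rewrite -amplM mulVmx // ampl1.
have -> : ampl E S *m b *m ampl E (invmx S) - Y%:M =
    ampl E S *m (b - Y%:M) *m ampl E (invmx S).
  rewrite mulmxBr mulmxBl; congr (_ - _).
  by rewrite -scalar_ampl_comm -mulmxA SV mulmx1.
split; rewrite -!mulmxA [ampl E (invmx S) *m _]mulmxA VS mul1mx.
  by rewrite [(b - _) *m _]mulmxA h1 mul1mx SV.
by rewrite [resolvent Y b *m _]mulmxA h2 mul1mx SV.
Qed.

Lemma resolvent_star n (b : 'M[E]_n) : star Y = Y -> rho B Y b ->
  rho B Y (mxstar b) /\ resolvent Y (mxstar b) = mxstar (resolvent Y b).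
Proof.
move=> hY rb; have [h1 h2] := resolventP rb.
have inv : mx_is_inv (mxstar b - Y%:M) (mxstar (resolvent Y b)).
  have -> : mxstar b - Y%:M = mxstar (b - Y%:M).
    by rewrite mxstarB mxstar_scalar hY.
  by split; rewrite -mxstarM ?h1 ?h2 mxstar_scalar star1.
split; last exact: mxinv_eq.
apply: rhoI inv => i j; rewrite mxstarE.
by have [_ _ Bs] := hB; apply: Bs; case: rb.
Qed.

End ResolventAlgebra.

(** * Approximation in norm and bounded functionals *)

Section Approximation.
Variables (C : numClosedFieldType) (E : cstarAlgType C).
Implicit Types (x y z : E) (S : set E).

(** The C*-identity gives [anorm y ^+ 2 <= anorm (star y) * anorm y]; divide by [anorm y], then
    apply the inequality to [star x] as well. *)
Lemma anorm_star x : anorm (star x) = anorm x.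
Proof.
have le y : anorm y <= anorm (star y).
  have [->|y0] := eqVneq (anorm y) 0; first exact: anorm_ge0.
  have y_gt0 : 0 < anorm y by rewrite lt0r y0 anorm_ge0.
  by rewrite -(ler_pM2r y_gt0) -expr2 -anorm_starM anormM_le.
by apply/eqP; rewrite eq_le le andbT -{2}(starK x) le.
Qed.

Lemma eps_eq0 (u : C) : (forall e, 0 < e -> `|u| <= e) -> u = 0.
Proof.
move=> h; apply/eqP; case: eqP => // /eqP u0.
have := h (`|u| / 2) (divr_gt0 _ (ltr0Sn _ _)).
rewrite normr_gt0 u0 => /(_ isT) /=.
by rewrite ler_pdivlMr // mulr_natr mulr2n gerDl normr_le0 (negPf u0).
Qed.

Lemma small_factor (k e : C) : 0 <= k -> 0 < e ->
  exists r : C, [/\ 0 < r, r <= 1 & forall t, 0 <= t -> t < r -> t * k < e].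
Proof.
move=> k0 e0; have d0 : 0 < e + (k + 1) by rewrite addr_gt0 // ltr_wpDl.
(* This denominator is positive even for [k = 0], and it exceeds both [e] and [k], which yields the
   two bounds at once. *)
exists (e / (e + (k + 1))); split.
- exact: divr_gt0.
- by rewrite ler_pdivrMr // mul1r lerDl addr_ge0.
- move=> t t0; rewrite ltr_pdivlMr //; apply: le_lt_trans.
  by rewrite ler_wpM2l // addrCA lerDl addr_ge0 // ltW.
Qed.

(** The norm closure of [S], stated on [E] rather than on [banach E] so that it can be combined with
    the ring operations. *)
Definition approx S : set E :=
  [set x | forall e : C, 0 < e -> exists2 z, S z & anorm (x - z) < e].

Lemma approx_sub S x : S x -> approx S x.
Proof. by move=> Sx e e0; exists x => //; rewrite subrr anorm0. Qed.

Lemma approx_approx S x : approx (approx S) x -> approx S x.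
Proof.
move=> h e e0; have e2 : 0 < e / 2 by rewrite divr_gt0.
have [y Sy xy] := h _ e2; have [z Sz yz] := Sy _ e2.
exists z => //; apply: le_lt_trans (anormB_le x y z) _.
by rewrite [ltRHS](splitr e) ltrD.
Qed.

Lemma approxD S : (forall x y, S x -> S y -> S (x + y)) ->
  forall x y, approx S x -> approx S y -> approx S (x + y).
Proof.
move=> SD x y Sx Sy e e0; have e2 : 0 < e / 2 by rewrite divr_gt0.
have [x' Sx' xx'] := Sx _ e2; have [y' Sy' yy'] := Sy _ e2.
exists (x' + y'); first exact: SD.
rewrite opprD addrACA; apply: le_lt_trans (anormD_le _ _) _.
by rewrite [ltRHS](splitr e) ltrD.
Qed.

Lemma approxZ S : (forall a x, S x -> S (a *: x)) ->
  forall a x, approx S x -> approx S (a *: x).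
Proof.
move=> SZ a x Sx e e0.
have [r [r0 r1 hr]] := small_factor (normr_ge0 a) e0.
have [x' Sx' xx'] := Sx _ r0; exists (a *: x'); first exact: SZ.
by rewrite -scalerBr anormZ mulrC hr // anorm_ge0.
Qed.

(** The second radius may depend on [x']: the factors are approximated one after the other, so no
    bound on [x'] is needed beforehand. *)
Lemma anormM_near x y e : 0 < e -> exists2 r : C, 0 < r &
  forall x', anorm (x - x') < r -> exists2 r' : C, 0 < r' &
  forall y', anorm (y - y') < r' -> anorm (x * y - x' * y') < e.
Proof.
move=> e0; have e2 : 0 < e / 2 by rewrite divr_gt0.
have [r [r0 r1 hr]] := small_factor (anorm_ge0 y) e2; exists r => // x' xx'.
have [r' [r'0 _ hr']] := small_factor (anorm_ge0 x') e2; exists r' => // y' yy'.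
have -> : x * y - x' * y' = (x - x') * y + x' * (y - y').
  by rewrite mulrBl mulrBr addrA subrK.
apply: le_lt_trans (anormD_le _ _) _; rewrite [ltRHS](splitr e) ltrD //.
  by apply: le_lt_trans (anormM_le _ _) _; apply: hr => //; exact: anorm_ge0.
apply: le_lt_trans (anormM_le _ _) _; rewrite mulrC.
by apply: hr' => //; exact: anorm_ge0.
Qed.

Lemma approxM S : (forall x y, S x -> S y -> S (x * y)) ->
  forall x y, approx S x -> approx S y -> approx S (x * y).
Proof.
move=> SM x y Sx Sy e e0.
have [r r0 hr] := anormM_near x y e0.
have [x' Sx' /hr [r' r'0 hr']] := Sx _ r0; have [y' Sy' yy'] := Sy _ r'0.
by exists (x' * y'); [exact: SM | exact: hr'].
Qed.

Lemma dense_approx S : dense (S : set (banach E)) -> forall x, approx S x.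
Proof.
move=> dS x e e0.
have [|z [zO Sz]] := dS (ball (x : banach E) e)° _ (open_interior _).
  by exists x;
    exact: nbhs_singleton (nbhs_interior (nbhsx_ballx (x : banach E) e e0)).
exists z => //; have := interior_subset zO; rewrite -ball_normE; exact.
Qed.

Lemma continuous_scalar_bounded (phi : {scalar E}) :
  continuous (phi : banach E -> C^o) ->
  exists2 c : C, 0 <= c & forall x, `|phi x| <= c * anorm x.
Proof.
move=> cphi.
have := cphi (0 : banach E); rewrite /continuous_at.
move=> /cvgrPdist_lt /(_ 1 ltr01).
move=> /nbhs_ballP [r /= r0 hr].
exists (2 / r); first by rewrite divr_ge0 // ltW.
move=> x; have [x0|x0] := eqVneq (anorm x) 0.
  by rewrite (anorm0_eq0 x x0) raddf0 normr0 anorm0 mulr0.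
have x_gt0 : 0 < anorm x by rewrite lt0r x0 anorm_ge0.
(* Rescales [x] to norm [r / 2], inside the ball on which [phi] is smaller than 1. *)
pose t := r / (2 * anorm x).
have t0 : 0 < t by rewrite divr_gt0 // mulr_gt0.
have : `|phi (t *: x)| < 1.
  have := hr (t *: x); rewrite raddf0 sub0r normrN; apply.
  rewrite -ball_normE /ball_ /= sub0r normrN.
  rewrite -[ltLHS]/(anorm (t *: x)) anormZ gtr0_norm // /t invfM mulrA.
  by rewrite mulfVK // ltr_pdivrMr // mulr_natr mulr2n ltrDl.
rewrite linearZ normrM gtr0_norm // /t => /ltW.
rewrite mulrAC ler_pdivrMr ?mulr_gt0 // mul1r -ler_pdivlMl //.
by rewrite mulrA [r^-1 * 2]mulrC.
Qed.

Section Bounded.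
Variables (phi : {scalar E}) (c : C).
Hypotheses (c0 : 0 <= c) (hc : forall x, `|phi x| <= c * anorm x).

Lemma scalar_eq0_approx S : (forall x, approx S x) ->
  (forall x, S x -> phi x = 0) -> forall x, phi x = 0.
Proof.
move=> aS S0 x; apply: eps_eq0 => e e0.
have [r [r0 r1 hr]] := small_factor c0 e0; have [z Sz xz] := aS x _ r0.
rewrite -[phi x]subr0 -(S0 z Sz) -raddfB; apply: le_trans (hc _) _.
by rewrite mulrC ltW // hr // anorm_ge0.
Qed.

Lemma scalar_ge0_approx S : (forall x, approx S x) ->
  (forall z, S z -> 0 <= phi (z * star z)) -> forall x, 0 <= phi (x * star x).
Proof.
move=> aS S0 x; set u := phi _.
(* The order on [C] is partial, so nonnegativity is recast as the equation [|u| = u], which is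
   stable under limits. *)
suff /subr0_eq <- : `|u| - u = 0 by exact: normr_ge0.
apply: eps_eq0 => e e0; have e2 : 0 < e / 2 by rewrite divr_gt0.
have [r [r0 _ hr]] := small_factor c0 e2.
(* The constant bounds [anorm x + anorm z]: taking [s <= 1] below ensures
   [anorm z <= anorm x + 1]. *)
have k0 : 0 <= 2 * anorm x + 1 by rewrite addr_ge0 // mulr_ge0 // anorm_ge0.
have [s [s0 s1 hs]] := small_factor k0 r0.
have [z Sz xz] := aS x _ s0; have t0 := anorm_ge0 (x - z).
have zx : anorm z <= anorm x + 1.
  have -> : z = x - (x - z) by rewrite opprB addrCA subrr addr0.
  apply: le_trans (anormD_le _ _) _; rewrite anormN lerD2l.
  exact: le_trans (ltW xz) s1.
have uz : `|u - phi (z * star z)| < e / 2.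
  rewrite -raddfB; apply: le_lt_trans (hc _) _; rewrite mulrC.
  apply: hr; first exact: anorm_ge0.
  apply: le_lt_trans (hs _ t0 xz).
  have -> : x * star x - z * star z = (x - z) * star x + z * star (x - z).
    by rewrite mulrBl starD starN mulrBr addrA subrK.
  apply: le_trans (anormD_le _ _) _.
  have -> : 2 * anorm x + 1 = anorm x + (anorm x + 1).
    by rewrite mulr_natl mulr2n addrA.
  rewrite mulrDr; apply: lerD; apply: le_trans (anormM_le _ _) _.
    by rewrite anorm_star.
  by rewrite anorm_star mulrC ler_wpM2l.
set p := phi _ in uz; have p0 : 0 <= p := S0 z Sz.
have -> : `|u| - u = (`|u| - p) + (p - u) by rewrite addrA subrK.
apply: le_trans (ler_normD _ _) _; rewrite [leRHS](splitr e) lerD //.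
  by rewrite -(ger0_norm p0); apply: le_trans (ler_dist_dist _ _) (ltW uz).
by rewrite distrC ltW.
Qed.

End Bounded.
End Approximation.

(** * The Neumann series *)

Section Neumann.
Variables (C : numClosedFieldType) (E : cstarAlgType C).
Hypothesis archi : Num.archimedean_axiom C.
Implicit Types x y z : E.

(** The archimedean axiom bounds [c / e] by some [N], and [n < 2 ^ n]. *)
Lemma geometric_small (c e : C) : 0 <= c -> 0 < e ->
  exists N, forall n, (N <= n)%N -> c * 2^-1 ^+ n < e.
Proof.
move=> c0 e0; have [N hN] := archi (c / e); exists N => n Nn.
rewrite exprVn ltr_pdivrMr ?exprn_gt0 // mulrC -ltr_pdivrMr //.
rewrite -(ger0_norm (divr_ge0 c0 (ltW e0))); apply: lt_le_trans hN _.
by rewrite -natrX ler_nat (leq_trans Nn) // ltnW // ltn_expl.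
Qed.

Lemma anormX_le x n : anorm x <= 2^-1 ->
  anorm (x ^+ n) <= anorm (1 : E) * 2^-1 ^+ n.
Proof.
move=> hx; elim: n => [|n ih]; first by rewrite expr0 mulr1.
rewrite exprS; apply: le_trans (anormM_le _ _) _.
rewrite [_ ^+ n.+1]exprS mulrCA; apply: ler_pM => //; exact: anorm_ge0.
Qed.

Lemma geometric_sum x n : (1 - x) * (\sum_(i < n) x ^+ i) = 1 - x ^+ n /\
  (\sum_(i < n) x ^+ i) * (1 - x) = 1 - x ^+ n.
Proof.
have e1 : (1 - x) * (\sum_(i < n) x ^+ i) = 1 - x ^+ n.
  by rewrite -[RHS]opprB subrX1 -mulNr opprB.
split=> //; rewrite -e1 mulr_suml mulr_sumr; apply: eq_bigr => i _.
by rewrite mulrBl mulrBr mul1r mulr1 -exprS -exprSr.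
Qed.

Lemma geometric_sum_le x n : anorm x <= 2^-1 ->
  anorm (\sum_(i < n) x ^+ i) <= 2 * anorm (1 : E).
Proof.
move=> hx; elim: n => [|n ih].
  by rewrite big_ord0 anorm0 mulr_ge0 // anorm_ge0.
rewrite big_ord_recl expr0 mulr_natl mulr2n; apply: le_trans (anormD_le _ _) _.
rewrite lerD2l; under eq_bigr do rewrite lift0 exprS.
rewrite -mulr_sumr; apply: le_trans (anormM_le _ _) _.
apply: le_trans (ler_pM (anorm_ge0 _) (anorm_ge0 _) hx ih) _.
by rewrite mulKf.
Qed.

Lemma geometric_cvg x : anorm x <= 2^-1 -> exists l : E, forall e : C, 0 < e ->
  exists N, forall n, (N <= n)%N -> anorm (l - \sum_(i < n) x ^+ i) < e.
Proof.
move=> hx; pose s n : banach E := \sum_(i < n) x ^+ i.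
have k0 := anorm_ge0 (1 : E).
have : cvg (s n @[n --> \oo]).
  apply: banach_complete; apply: cauchy_exP => e e0.
  have [N hN] := geometric_small (c := 2 * anorm (1 : E) * anorm (1 : E))
    (mulr_ge0 (mulr_ge0 (ler0n _ _) k0) k0) e0.
  exists (s N); exists N => // n /= Nn; rewrite -ball_normE /ball_ /=.
  rewrite distrC -[ltLHS]/(anorm (\sum_(i < n) x ^+ i - \sum_(i < N) x ^+ i)).
  (* A block of the series is [x ^+ N] times a partial sum; the first factor decays and the second
     is uniformly bounded. *)
  have -> : \sum_(i < n) x ^+ i - \sum_(i < N) x ^+ i =
      x ^+ N * \sum_(i < n - N) x ^+ i.
    have -> : n = (N + (n - N))%N by rewrite subnKC.
    apply/eqP; rewrite subr_eq addrC big_split_ord mulr_sumr addKn /=.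
    by apply/eqP; congr (_ + _); apply: eq_bigr => i _; rewrite exprD.
  apply: le_lt_trans (anormM_le _ _) _.
  apply: le_lt_trans (hN N (leqnn N)).
  apply: le_trans (ler_pM (anorm_ge0 _) (anorm_ge0 _) (anormX_le N hx)
    (geometric_sum_le (n - N) hx)) _.
  by rewrite mulrC mulrA.
move=> /cvg_ex [l /cvgrPdist_lt sl]; exists l => e e0.
by have [N _ hN] := sl e e0; exists N => n /hN.
Qed.

Lemma neumann x : anorm x <= 2^-1 -> exists s : E,
  [/\ (1 - x) * s = 1, s * (1 - x) = 1 &
      anorm (1 - s) <= anorm x * (2 * anorm (1 : E))].
Proof.
move=> hx; have [l hl] := geometric_cvg hx; have k0 := anorm_ge0 (1 : E).
(* Both terms of the bound tend to 0: the truncation error of the series and the power left over by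
   the finite geometric sum. *)
have lim0 (u : E) (k : C) : 0 <= k -> (forall n, anorm u <=
    anorm (l - \sum_(i < n) x ^+ i) * k + anorm (x ^+ n)) -> u = 0.
  move=> k_ge0 hu; apply: (anorm0_eq0 u); apply: eps_eq0 => e e0.
  have e2 : 0 < e / 2 by rewrite divr_gt0.
  have [r [r0 _ hr]] := small_factor k_ge0 e2; have [N hN] := hl r r0.
  have [N' hN'] := geometric_small k0 e2; pose n := maxn N N'.
  rewrite ger0_norm ?anorm_ge0 //; apply: le_trans (hu n) _.
  rewrite [leRHS](splitr e) lerD //.
    by rewrite ltW // hr ?anorm_ge0 // hN // leq_maxl.
  by apply: le_trans (anormX_le n hx) _; rewrite ltW // hN' // leq_maxr.
have sl : (1 - x) * l = 1.
  apply/subr0_eq/(lim0 _ (anorm (1 - x))) => [|n]; first exact: anorm_ge0.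
  have -> : (1 - x) * l - 1 = (1 - x) * (l - \sum_(i < n) x ^+ i) - x ^+ n.
    by rewrite mulrBr (geometric_sum x n).1 opprB addrA addrAC addrK.
  apply: le_trans (anormD_le _ _) _; rewrite anormN lerD2r mulrC.
  exact: anormM_le.
have ls : l * (1 - x) = 1.
  apply/subr0_eq/(lim0 _ (anorm (1 - x))) => [|n]; first exact: anorm_ge0.
  have -> : l * (1 - x) - 1 = (l - \sum_(i < n) x ^+ i) * (1 - x) - x ^+ n.
    by rewrite mulrBl (geometric_sum x n).2 opprB addrA addrAC addrK.
  apply: le_trans (anormD_le _ _) _; rewrite anormN lerD2r.
  exact: anormM_le.
exists l; split => //.
have lx : 1 - l = - (x * l).
  by rewrite -[X in X - l]sl mulrBl mul1r addrAC subrr sub0r.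
rewrite lx anormN; apply: le_trans (anormM_le _ _) _.
rewrite ler_wpM2l ?anorm_ge0 //.
(* From [l = 1 + x * l]; absorbing the last term on the left gives [anorm l <= 2 * anorm 1]. *)
have : anorm l <= anorm (1 : E) + 2^-1 * anorm l.
  have {1}-> : l = 1 + x * l by rewrite -[x * l]opprK -lx opprB addrC subrK.
  apply: le_trans (anormD_le _ _) _; rewrite lerD2l.
  apply: le_trans (anormM_le _ _) _; rewrite ler_wpM2r ?anorm_ge0 //.
rewrite -lerBlDr -{1}[anorm l]mul1r -mulrBl.
have -> : 1 - 2^-1 = 2^-1 :> C by rewrite {1}[1](splitr 1) mul1r addrK.
by rewrite ler_pdivrMl.
Qed.

End Neumann.

(** * Density of the coefficients of resolvents *)

Section ResolventCoefficients.
Variables (C : numClosedFieldType) (E : cstarAlgType C) (B : set E) (Y : E).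
Hypotheses (hB : unital_cstar_subalg B) (archi : Num.archimedean_axiom C).
Implicit Types x y z : E.

(** The set Z of the overview. Complex rows and columns are used instead of single entries so that
    sums and multiples stay in the set. *)
Definition res_coef : set E :=
  [set x | exists n (b : 'M[E]_n) (v : 'rV[C]_n) (w : 'cV[C]_n),
    [/\ (0 < n)%N, rho B Y b &
      x = (ampl E v *m resolvent Y b *m ampl E w) 0 0]].

Lemma res_coefZ a x : res_coef x -> res_coef (a *: x).
Proof.
move=> [n [b [v [w [n0 rb ->]]]]]; exists n, b, (a *: v), w; split => //.
rewrite -!mulmxA !mxE scaler_sumr; apply: eq_bigr => i _.
by rewrite !mxE scalerAl scalerA.
Qed.

Lemma res_coefD x y : res_coef x -> res_coef y -> res_coef (x + y).
Proof.
case=> n [b [v [w [n0 rb ->]]]] [n' [b' [v' [w' [n'0 rb' ->]]]]].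
have [rbb resE] := resolvent_diag hB rb rb'.
exists (n + n')%N, (block_mx b 0 0 b'), (row_mx v v'), (col_mx w w').
split; [by rewrite addn_gt0 n0 | exact: rbb | rewrite resE].
rewrite ampl_row_mx ampl_col_mx mul_row_block !mulmx0 addr0 add0r.
by rewrite mul_row_col [RHS]mxE.
Qed.

(* The upper right corner of the resolvent of an upper triangular block matrix
   with corner [X] is [- R' X R'']; take [X := w c v']. *)
Lemma res_coefM c x y : B c -> res_coef x -> res_coef y ->
  res_coef (x * c * y).
Proof.
move=> Bc [n [b [v [w [n0 rb ->]]]]] [n' [b' [v' [w' [n'0 rb' ->]]]]].
pose X := ampl E w *m (c%:M : 'M[E]_1) *m ampl E v'.
have BX : mx_over B X.
  apply: (mx_overM hB); last exact: mx_over_ampl.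
  apply: (mx_overM hB); first exact: mx_over_ampl.
  move=> i j; rewrite mxE.
  by case: (i == j); rewrite ?mulr1n // ?mulr0n; exact: cstar_subalg0.
have [rbb resE] := resolvent_block hB rb rb' BX.
rewrite -[_ * c * _]opprK -scaleN1r; apply: res_coefZ.
exists (n + n')%N, (block_mx b X 0 b'), (row_mx v 0), (col_mx 0 w').
split; [by rewrite addn_gt0 n0 | exact: rbb | rewrite resE].
rewrite ampl_row_mx ampl_col_mx mul_row_block !ampl0.
rewrite !(mulmx0, mul0mx, addr0) mul_row_col mulmx0 add0r.
rewrite mulmxN mulNmx [RHS]mxE.
have -> : ampl E v *m (resolvent Y b *m X *m resolvent Y b') *m ampl E w' =
    (ampl E v *m resolvent Y b *m ampl E w) *m c%:M *m
    (ampl E v' *m resolvent Y b' *m ampl E w') by rewrite /X !mulmxA.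
move: (ampl E v *m _ *m _) (ampl E v' *m _ *m _) => p q.
congr (- _); rewrite [RHS]mxE big_ord1.
by rewrite [(p *m _) _ _]mxE big_ord1 [c%:M _ _]mxE mulr1n.
Qed.

Lemma res_coef_entry n (b : 'M[E]_n) i j : (0 < n)%N -> rho B Y b ->
  res_coef (resolvent Y b i j).
Proof.
move=> n0 rb; exists n, b, (delta_mx 0 i), (delta_mx j 0); split => //.
rewrite /ampl (map_delta_mx (in_alg E)) (map_delta_mx (in_alg E)).
by rewrite -rowE -colE !mxE.
Qed.

(* [s = l (l - Y)^-1 = (1 - Y / l)^-1] tends to [1] as [l] tends to infinity. *)
Lemma res_coef_near1 e : 0 < e -> exists s (l : C),
  [/\ res_coef s, anorm (1 - s) < e & Y * s = l *: (s - 1)].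
Proof.
move=> e0; have k0 := anorm_ge0 (1 : E); have y0 := anorm_ge0 Y.
have [t [t0 _ ht]] := small_factor (mulr_ge0 (ler0n C 2) k0) e0.
have ti0 : 0 <= t^-1 by rewrite invr_ge0 ltW.
(* The summand 2 makes [Y / l] at most 1/2 in norm, as the Neumann series requires; the summand
   [t^-1] makes it smaller than [t], which bounds [1 - s] by [e]. *)
have [N] := archi (anorm Y * (2 + t^-1)).
rewrite ger0_norm ?mulr_ge0 ?addr_ge0 //; set l : C := N%:R => Nl.
have l0 : 0 < l by apply: le_lt_trans Nl; rewrite mulr_ge0 ?addr_ge0.
have lU : l != 0 by rewrite gt_eqF.
pose x := l^-1 *: Y.
have nx : anorm x = anorm Y / l.
  by rewrite anormZ gtr0_norm ?invr_gt0 // mulrC.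
have hx : anorm x <= 2^-1.
  rewrite nx ler_pdivrMr // mulrC ler_pdivlMr //; apply: le_trans (ltW Nl).
  by rewrite ler_wpM2l // lerDl.
have xt : anorm x < t.
  rewrite nx ltr_pdivrMr // -ltr_pdivrMl // mulrC; apply: le_lt_trans Nl.
  by rewrite ler_wpM2l // lerDr.
have [s [xs sx sle]] := neumann archi hx.
exists s, l; split; last 1 first.
- have -> : Y = l *: x by rewrite /x scalerA mulfV // scale1r.
  rewrite -scalerAl; congr (_ *: _).
  by rewrite -[1 in RHS]xs mulrBl mul1r opprB addrC subrK.
- have lY : l%:A - Y = l *: (1 - x).
    by rewrite scalerBr /x scalerA mulfV // scale1r.
  have inv : mx_is_inv ((l%:A)%:M - Y%:M) ((l^-1 *: s)%:M : 'M[E]_1).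
    rewrite -raddfB lY; split; rewrite -scalar_mxM -scalerAl -scalerAr scalerA.
      by rewrite mulfV // scale1r xs.
    by rewrite mulVf // scale1r sx.
  have rl : rho B Y ((l%:A)%:M : 'M[E]_1).
    apply: rhoI inv => i j; rewrite mxE !ord1 mulr1n.
    exact: cstar_subalg_alg.
  have -> : s = l *: resolvent Y ((l%:A)%:M : 'M[E]_1) 0 0.
    by rewrite /resolvent (mxinv_eq inv) mxE mulr1n scalerA mulfV // scale1r.
  by apply: res_coefZ; exact: res_coef_entry.
- exact: le_lt_trans sle (ht _ (anorm_ge0 x) xt).
Qed.

(** With [s] and [s'] in Z close to 1, the product [s * c * s'] lies in Z and is close to [c]. *)
Lemma approx_res_coef_subalg c : B c -> approx res_coef c.
Proof.
move=> Bc e e0; have [r r0 hr] := anormM_near c 1 e0.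
have [t [t0 _ ht]] := small_factor (anorm_ge0 c) r0.
have [s [_ [Zs s1 _]]] := res_coef_near1 t0.
have [|r' r'0 hr'] := hr (s * c).
  rewrite -{1}[c]mul1r -mulrBl; apply: le_lt_trans (anormM_le _ _) _.
  exact: ht (anorm_ge0 _) s1.
have [s' [_ [Zs' s'1 _]]] := res_coef_near1 r'0.
exists (s * c * s'); first exact: res_coefM.
by have := hr' s' s'1; rewrite mulr1.
Qed.

(** For [s] in Z close to 1, [Y * s] is close to [Y], and it equals [l *: (s - 1)], which is in the
    closure of Z because 1 belongs to [B]. *)
Lemma approx_res_coef_Y : approx res_coef Y.
Proof.
apply: approx_approx => e e0.
have [t [t0 _ ht]] := small_factor (anorm_ge0 Y) e0.
have [s [l [Zs s1 Ys]]] := res_coef_near1 t0.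
exists (Y * s); last first.
  rewrite -{1}[Y]mulr1 -mulrBr; apply: le_lt_trans (anormM_le _ _) _.
  by rewrite mulrC; exact: ht (anorm_ge0 _) s1.
rewrite Ys -[-1]scaleN1r; apply: approxZ => [a x|]; first exact: res_coefZ.
apply: approxD => [x y||]; first exact: res_coefD; first exact: approx_sub.
apply: approx_res_coef_subalg; exact: cstar_subalg_alg.
Qed.

Lemma RA_approx_res_coef x : RA B Y x -> approx res_coef x.
Proof.
apply: smallest_sub => [|y [[By|->]|[n [b [i [j [n0 rb ->]]]]]]].
- have B1 : B 1 by rewrite -[1]scale1r; exact: cstar_subalg_alg.
  split.
  + by apply/mem_set; exact: approx_res_coef_subalg.
  + move=> a y z /set_mem hy /set_mem hz; apply/mem_set.
    by apply: (approxD res_coefD) => //; exact: (approxZ res_coefZ).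
  + move=> y z /set_mem hy /set_mem hz; apply/mem_set.
    (* Z is closed under products: insert 1, an element of [B], between the factors. *)
    apply: approxM => // u v Zu Zv; rewrite -[u]mulr1; exact: res_coefM.
- exact: approx_res_coef_subalg.
- exact: approx_res_coef_Y.
- exact/approx_sub/res_coef_entry.
Qed.

Lemma dense_res_coef : dense (RA B Y : set (banach E)) ->
  forall x, approx res_coef x.
Proof.
move=> dRA x; apply: approx_approx => e e0.
by have [z /RA_approx_res_coef Zz xz] := dense_approx dRA x e0; exists z.
Qed.

End ResolventCoefficients.

(** * The l1 norm of matrices and multilinear products *)

Section MatrixNorm.
Variables (C : numClosedFieldType) (E : cstarAlgType C).

Lemma mx_l1norm_ge0 m n (A : 'M[E]_(m, n)) : 0 <= mx_l1norm A.
Proof. by apply: sumr_ge0 => i _; apply: sumr_ge0 => j _; exact: anorm_ge0. Qed.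

Lemma mx_l1normD_le m n (A A' : 'M[E]_(m, n)) :
  mx_l1norm (A + A') <= mx_l1norm A + mx_l1norm A'.
Proof.
rewrite -big_split; apply: ler_sum => i _.
rewrite -big_split; apply: ler_sum => j _.
by rewrite mxE anormD_le.
Qed.

Lemma mx_l1normN m n (A : 'M[E]_(m, n)) : mx_l1norm (- A) = mx_l1norm A.
Proof.
by apply: eq_bigr => i _; apply: eq_bigr => j _; rewrite mxE anormN.
Qed.

Lemma mx_l1normM_le m n p (A : 'M[E]_(m, n)) (A' : 'M[E]_(n, p)) :
  mx_l1norm (A *m A') <= mx_l1norm A * mx_l1norm A'.
Proof.
have -> : mx_l1norm A * mx_l1norm A' =
    \sum_i \sum_k anorm (A i k) * mx_l1norm A'.
  by rewrite mulr_suml; apply: eq_bigr => i _; rewrite mulr_suml.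
apply: ler_sum => i _.
apply: (@le_trans _ _ (\sum_j \sum_k anorm (A i k) * anorm (A' k j))).
  apply: ler_sum => j _; rewrite mxE; apply: le_trans (anorm_sum_le _ _ _) _.
  by apply: ler_sum => k _; exact: anormM_le.
rewrite exchange_big; apply: ler_sum => k _.
rewrite -mulr_sumr ler_wpM2l ?anorm_ge0 // /mx_l1norm (bigD1 k) //= lerDl.
by apply: sumr_ge0 => l _; apply: sumr_ge0 => j _; exact: anorm_ge0.
Qed.

Lemma mx_l1norm_prod_le n I (r : seq I) (u : 'M[E]_n) (F : I -> 'M[E]_n) :
  mx_l1norm (u * \prod_(i <- r) F i) <=
  mx_l1norm u * \prod_(i <- r) mx_l1norm (F i).
Proof.
elim: r u => [|i r ih] u; first by rewrite !big_nil !mulr1.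
rewrite !big_cons mulrA; apply: le_trans (ih _) _; rewrite mulrA.
rewrite ler_wpM2r ?mx_l1normM_le //; apply: prodr_ge0 => j _.
exact: mx_l1norm_ge0.
Qed.

Lemma central_scalemx n (a : C) (A A' : 'M[E]_n) :
  A * (a%:A *: A') = a%:A *: (A * A').
Proof.
apply/matrixP => i j; rewrite !mxE mulr_sumr; apply: eq_bigr => k _.
by rewrite !mxE -!scalerAl !mul1r scalerAr.
Qed.

(** The factors do not commute, but the scalar [a%:A] is central and can be pulled out to the left;
    [uniq r] guarantees that the factor [i] occurs only once. *)
Lemma prod_multilinear n (I : eqType) (r : seq I) (i : I) (a : C)
    (F G H : I -> 'M[E]_n) :
  uniq r -> i \in r -> (forall j, j != i -> F j = G j /\ F j = H j) ->
  F i = a%:A *: G i + H i ->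
  \prod_(j <- r) F j = a%:A *: \prod_(j <- r) G j + \prod_(j <- r) H j.
Proof.
move=> + + FGH Fi; elim: r => // j r ih /= /andP [jr ur].
rewrite inE !big_cons; have [ij _|ij /= ir] := eqVneq i j.
  subst j.
  have FGHr k : k \in r -> F k = G k /\ F k = H k.
    by move=> kr; apply: FGH; apply: contraNneq jr => <-.
  have FG : \prod_(k <- r) F k = \prod_(k <- r) G k.
    by apply: eq_big_seq => k /FGHr [].
  have FH : \prod_(k <- r) F k = \prod_(k <- r) H k.
    by apply: eq_big_seq => k /FGHr [].
  rewrite -FG -FH Fi mulrDl; congr (_ + _).
  exact/esym/scalemxAl.
have [|FG FH] := FGH j; first by rewrite eq_sym.
by rewrite ih // mulrDr central_scalemx -FG -FH.
Qed.

(** Expanding along the matrix units compares the norm of complex matrices with the l1 norm; the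
    constant [K] sums the norms of all the units. *)
Lemma map_scalar_bound (phi : {scalar E}) (c : C) m n : 0 <= c ->
  (forall x, `|phi x| <= c * anorm x) ->
  exists2 k : C, 0 <= k & forall A : 'M[E]_(m, n),
    `|map_mx phi A| <= k * mx_l1norm A.
Proof.
move=> c0 hc; pose K : C := \sum_i \sum_j `|delta_mx i j : 'M[C]_(m, n)|.
exists (c * K).
  by rewrite mulr_ge0 // sumr_ge0 // => i _; rewrite sumr_ge0.
move=> A; rewrite [X in `|X|]matrix_sum_delta.
have dK i j : `|delta_mx i j : 'M[C]_(m, n)| <= K.
  rewrite /K (bigD1 i) //= (bigD1 j) //= -addrA lerDl addr_ge0 //.
    by apply: sumr_ge0.
  by apply: sumr_ge0 => i' _; apply: sumr_ge0.
apply: le_trans (ler_norm_sum _ _ _) _; rewrite mulr_sumr.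
apply: ler_sum => i _; apply: le_trans (ler_norm_sum _ _ _) _.
rewrite mulr_sumr; apply: ler_sum => j _.
rewrite normrZ mxE mulrAC; apply: ler_pM => //.
Qed.

End MatrixNorm.

(** * Positive semidefinite complex matrices and the derivative of an affine path *)

Section ComplexMatrices.
Variable C : numClosedFieldType.
Local Open Scope sesquilinear_scope.

Lemma trmxC_mul m n p (A : 'M[C]_(m, n)) (A' : 'M[C]_(n, p)) :
  (A *m A')^t* = A'^t* *m A^t*.
Proof. by rewrite trmx_mul map_mxM. Qed.

(** Diagonalize [h] by the spectral theorem and take square roots of the eigenvalues. *)
Lemma psdmx_sqrt n (h : 'M[C]_n) : psdmx h -> exists k : 'M[C]_n, h = k *m k^t*.
Proof.
move=> [hh hp].
have /orthomx_spectralP : h \is normalmx by apply/normalmxP; rewrite hh.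
set P := spectralmx h; set sp := spectral_diag h.
have uP : P \is unitarymx := spectral_unitarymx h.
have PPt : P *m P^t* = 1%:M by apply/unitarymxP.
rewrite invmx_unitary // => hE.
have sp0 i : 0 <= sp 0 i.
  (* This vector is the [i]-th eigenvector, at which the quadratic form equals the [i]-th
     eigenvalue. *)
  have := hp (P^t* *m delta_mx i 0).
  rewrite trmxC_mul trmxCK trmx_delta (map_delta_mx Num.conj) hE.
  rewrite -!mulmxA [P *m (P^t* *m delta_mx _ _)]mulmxA PPt mul1mx.
  rewrite [P *m (P^t* *m _)]mulmxA PPt mul1mx -rowE.
  by rewrite -colE !mxE eqxx mulr1n.
exists (P^t* *m diag_mx (map_mx sqrtC sp)).
rewrite trmxC_mul trmxCK tr_diag_mx map_diag_mx -!mulmxA.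
rewrite [diag_mx _ *m (diag_mx _ *m _)]mulmxA mulmx_diag hE -mulmxA.
congr (_ *m (diag_mx _ *m _)); apply/rowP => i.
rewrite !mxE -[LHS]sqrtCK expr2; congr (_ * _).
by apply/esym/geC0_conj; rewrite sqrtC_ge0.
Qed.

Lemma psdmx_rank1 n (w : 'cV[C]_n) : psdmx (w *m w^t*).
Proof.
split=> [|v]; first by rewrite trmxC_mul trmxCK.
have -> : v^t* *m (w *m w^t*) *m v = (v^t* *m w) *m (v^t* *m w)^t*.
  by rewrite trmxC_mul trmxCK !mulmxA.
by rewrite mxE big_ord1 !mxE mul_conjC_ge0.
Qed.

Lemma derive1_affine m n (A D : 'M[C]_(m, n)) :
  derive1 (fun eps : C => A + eps *: D) 0 = D.
Proof.
rewrite /derive1; apply: cvg_lim => //.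
apply: cvg_near_cst; near=> h.
rewrite addr0 scale0r addr0 [A + _]addrC addrK scalerA mulVf ?scale1r //.
by near: h; exact: nbhs_dnbhs_neq.
Unshelve. all: by end_near.
Qed.

End ComplexMatrices.

(** * The transform of a functional: adjoints, injectivity, positivity and analyticity *)

Section Functional.
Variables (C : numClosedFieldType) (E : cstarAlgType C) (B : set E) (Y : E).
Hypotheses (hB : unital_cstar_subalg B) (archi : Num.archimedean_axiom C).
Local Open Scope sesquilinear_scope.

Lemma map_scalar_ampll (phi : {scalar E}) m n p
    (h : 'M[C]_(m, n)) (A : 'M[E]_(n, p)) :
  map_mx phi (ampl E h *m A) = h *m map_mx phi A.
Proof.
apply/matrixP => i j; rewrite !mxE raddf_sum; apply: eq_bigr => k _.
rewrite !mxE -scalerAl mul1r; exact: scalarZ.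
Qed.

Lemma map_scalar_amplr (phi : {scalar E}) m n p
    (A : 'M[E]_(m, n)) (h : 'M[C]_(n, p)) :
  map_mx phi (A *m ampl E h) = map_mx phi A *m h.
Proof.
apply/matrixP => i j; rewrite !mxE raddf_sum; apply: eq_bigr => k _.
rewrite !mxE -scalerAr mulr1 [RHS]mulrC; exact: scalarZ.
Qed.

Lemma map_scalar_amplZ (phi : {scalar E}) m n p q (a : C) (A : 'M[E]_(m, n))
    (h : 'M[C]_(n, p)) (A' : 'M[E]_(p, q)) :
  map_mx phi (A *m ampl E (a *: h) *m A') =
  a *: map_mx phi (A *m ampl E h *m A').
Proof.
apply/matrixP => i j; rewrite [LHS]mxE [RHS]mxE [in RHS]mxE.
rewrite -[RHS](scalarZ phi); congr (phi _).
rewrite mxE [X in _ = _ *: X]mxE scaler_sumr; apply: eq_bigr => l _.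
rewrite [RHS]scalerAl; congr (_ * _).
rewrite mxE [X in _ = _ *: X]mxE scaler_sumr; apply: eq_bigr => k _.
by rewrite !amplE mxE -scalerA -scalerAr.
Qed.

Lemma nabla_Utrans (phi : {scalar E}) m n (b' : 'M[E]_m) (b'' : 'M[E]_n) h :
  rho B Y b' -> rho B Y b'' ->
  nabla (fseq_opp (Utrans Y phi)) b' b'' h =
    map_mx phi (resolvent Y b' *m ampl E h *m resolvent Y b'').
Proof.
move=> rb' rb''; rewrite /nabla; set R' := resolvent Y b'.
set R'' := resolvent Y b''.
pose A := - block_mx (map_mx phi R') 0 0 (map_mx phi R'').
pose D : 'M[C]_(m + n) := block_mx 0 (map_mx phi (R' *m ampl E h *m R'')) 0 0.
(* The resolvent is exactly affine in its corner, so the path is affine in [eps] with slope [D]; the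
   sign of [fseq_opp] cancels the one in the corner. *)
have -> : (fun eps : C => fseq_opp (Utrans Y phi)
    (block_mx b' (ampl E (eps *: h)) 0 b'')) = (fun eps => A + eps *: D).
  apply/funext => eps; rewrite /fseq_opp /Utrans.
  have [_ ->] := resolvent_block hB rb' rb'' (mx_over_ampl hB (eps *: h)).
  rewrite map_block_mx /A /D scale_block_mx !opp_block_mx add_block_mx.
  rewrite !scaler0 !addr0 !oppr0 !add0r.
  have map0 p q : map_mx phi (0 : 'M[E]_(p, q)) = 0 by rewrite map_mx0.
  rewrite !map0 oppr0 map_mxN opprK; congr block_mx.
  exact: map_scalar_amplZ.
by rewrite derive1_affine block_mxKur.
Qed.

Lemma dual_star_linear (phi : {scalar E}) : scalar (dual_star phi).
Proof.
move=> a x y; rewrite /dual_star star_semilinear linearP rmorphD rmorphM.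
by congr (_ * _ + _); exact: conjCK.
Qed.

HB.instance Definition _ (phi : {scalar E}) :=
  GRing.isLinear.Build C E C *%R (dual_star phi) (@dual_star_linear phi).

Lemma Utrans_dual_star phi : star Y = Y ->
  fseq_eq B Y (Utrans Y (dual_star phi)) (fseq_star (Utrans Y phi)).
Proof.
move=> hY n b n0 rb; rewrite /fseq_star /Utrans.
have [_ ->] := resolvent_star hB hY rb.
by apply/matrixP => i j; rewrite !mxE /dual_star.
Qed.

(** Linearity moves complex rows and columns through [phi]; thus the transform determines [phi] on
    Z. *)
Lemma map_scalar_res_coef (phi : {scalar E}) n (b : 'M[E]_n)
    (v : 'rV[C]_n) (w : 'cV[C]_n) :
  phi ((ampl E v *m resolvent Y b *m ampl E w) 0 0) =
  (v *m Utrans Y phi b *m w) 0 0.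
Proof.
by rewrite -map_scalar_ampll -map_scalar_amplr [RHS]mxE.
Qed.

Section Bound.
Variables (phi : {scalar E}) (c : C).
Hypotheses (hY : star Y = Y) (dRA : dense (RA B Y : set (banach E))).
Hypotheses (c0 : 0 <= c) (hc : forall x, `|phi x| <= c * anorm x).

Lemma Utrans_selfadjoint_eq :
  fseq_eq B Y (fseq_star (Utrans Y phi)) (Utrans Y phi) ->
  phi = dual_star phi :> (E -> C).
Proof.
move=> hU; apply/funext => x; apply/subr0_eq.
pose psi : {scalar E} := phi \- dual_star phi.
rewrite -[LHS]/(psi x).
(* Each of [phi] and its dual contributes [c], because the involution is isometric. *)
apply: (scalar_eq0_approx (c := c + c)) (dense_res_coef hB archi dRA) _ _.
- exact: addr_ge0.
- move=> y; rewrite mulrDl; apply: le_trans (ler_normB _ _) _.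
  by rewrite lerD ?hc // /dual_star norm_conjC -(anorm_star y) hc.
move=> y [n [b [v [w [n0 rb ->]]]]].
rewrite -[LHS]/(phi _ - dual_star phi _) !map_scalar_res_coef.
by rewrite Utrans_dual_star // hU // subrr.
Qed.

Lemma positive_of_dual_positive :
  dual_positive B Y (fseq_opp (Utrans Y phi)) -> positive_functional phi.
Proof.
move=> [_ _ hpos] a; rewrite -{2}(starK a).
apply: (scalar_ge0_approx c0 hc (dense_res_coef hB archi dRA)).
move=> _ [n [b [v [w [n0 rb ->]]]]].
(* Testing with [h = w *m w^t*] at the vector [v^t*] turns the quadratic form into [phi] of
   [z * star z], for [z = v R w] an element of Z. *)
have [_ /(_ (v^t*))] := hpos n b n0 rb _ (psdmx_rank1 w).
have [rbs rsE] := resolvent_star hB hY rb.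
rewrite trmxCK nabla_Utrans // -map_scalar_ampll -map_scalar_amplr mxE rsE.
set p := ampl E v *m resolvent Y b *m ampl E w.
suff -> : ampl E v *m (resolvent Y b *m ampl E (w *m w^t*) *m
    mxstar (resolvent Y b)) *m ampl E (v^t*) = p *m mxstar p.
  by rewrite [(p *m _) _ _]mxE big_ord1 mxstarE.
by rewrite /p !mxstarM !mxstar_ampl amplM !mulmxA.
Qed.

(** Expanding [star (x + 1) * (x + 1)] shows that [phi x + phi (star x)] is real; the same for
    ['i *: x] separates the two summands. *)
Lemma positive_selfadjoint : positive_functional phi ->
  phi = dual_star phi :> (E -> C).
Proof.
move=> pos.
have real x : (phi x)^* + (phi (star x))^* = phi x + phi (star x).
  have : phi x + phi (star x) \is Num.real.
    have -> : phi x + phi (star x) = phi (star (x + 1) * (x + 1)) -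
        phi (star x * x) - phi (star 1 * 1).
      rewrite -!raddfB -raddfD starD star1 mulrDl !mulrDr !mulr1 !mul1r.
      congr (phi _); rewrite -[_ + _ + (x + 1)]addrA [star x * x + _]addrC.
      by rewrite addrK addrA addrK addrC.
    by rewrite !rpredB ?ger0_real //; exact: pos.
  by move/conj_Creal; rewrite rmorphD.
apply/funext => x; rewrite /dual_star.
have := real ('i *: x); rewrite starZ !scalarZ !rmorphM /= conjCi.
set p := phi x; set q := phi (star x); rewrite rmorphN /= conjCi opprK => hi.
have e1 : q^* - p^* = p - q.
  by apply: (mulfI (neq0Ci C)); rewrite !mulrBr addrC -!mulNr.
(* Adding the two relations leaves twice the conjugate of [q] equal to twice [p]. *)
have : (q^* - p^*) + (p^* + q^*) = (p - q) + (p + q) by rewrite e1 real.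
rewrite addrA subrK [p + q]addrC addrA subrK -!mulr2n => /eqP.
by rewrite eqr_pMn2r // => /eqP.
Qed.

(* [S = R - S h R] for the resolvents [S] at [b + h] and [R] at [b]; iterate. *)
Lemma resolvent_expansion n (b h : 'M[E]_n) m : rho B Y b -> rho B Y (b + h) ->
  resolvent Y (b + h) =
    \sum_(k < m) resolvent Y b * (- h * resolvent Y b) ^+ k +
    resolvent Y (b + h) * (- h * resolvent Y b) ^+ m.
Proof.
move=> rb rbh; have [h1 h2] := resolventP rb; have [h3 h4] := resolventP rbh.
set R := resolvent Y b in h1 h2 *; set S := resolvent Y (b + h) in h3 h4 *.
have SE : S = R + S * (- h * R).
  have -> : S * (- h * R) = S *m (b - Y%:M) *m R - S *m (b + h - Y%:M) *m R.
    rewrite -mulmxBl -mulmxBr -[S * _]/(S *m (- h *m R)) mulmxA.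
    by congr (_ *m _ *m _); rewrite opprB addrA subrK opprD addrA subrr sub0r.
  by rewrite h4 mul1mx -mulmxA h1 mulmx1 addrC subrK.
move: SE; move: (- h * R) => T SE.
elim: m => [|m ih]; first by rewrite big_ord0 add0r expr0 mulr1.
rewrite big_ord_recr /= {1}ih -addrA; congr (_ + _).
by rewrite {1}SE mulrDl exprS mulrA.
Qed.

(** The expansion of the resolvent at [b + h] is a power series in [h], whose remainder [S T^m]
    decays geometrically, uniformly for small [h]. *)
Lemma Utrans_analytic n :
  analytic_on_rho B Y (fseq_opp (Utrans Y phi) (n := n)).
Proof.
move=> b rb; set R := resolvent Y b.
have R0 := mx_l1norm_ge0 R.
have [k k0 hk] := map_scalar_bound n n c0 hc.
have h0 : 0 < 2^-1 :> C by rewrite invr_gt0.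
(* The radius keeps [h R] at most 1/2 in l1 norm. The multilinear terms below arise by giving each
   factor [- h R] its own argument. *)
have [r [r0 _ hr]] := small_factor R0 h0.
exists r, (fun m (h : 'I_m -> 'M[E]_n) =>
  - map_mx phi (R * \prod_(i < m) (- h i * R))); split => //.
- move=> m; split.
  + move=> h i a x y _ _ _.
    rewrite (prod_multilinear (a := a) (i := i)
      (G := fun j => - [eta h with i |-> x] j * R)
      (H := fun j => - [eta h with i |-> y] j * R))
      ?index_enum_uniq ?mem_index_enum //.
    * rewrite mulrDr central_scalemx map_mxD opprD scalerN; congr (- _ - _).
      apply/matrixP => p q; rewrite mxE [in LHS]mxE [RHS]mxE [in RHS]mxE.
      by rewrite -scalerAl mul1r; exact: scalarZ.
    * by move=> j ij; rewrite /= (negPf ij).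
    * rewrite /= eqxx opprD mulrDl -scalerN; congr (_ + _).
      exact/esym/scalemxAl.
  + exists (k * mx_l1norm R * mx_l1norm R ^+ m) => h _.
    rewrite normrN; apply: le_trans (hk _) _.
    rewrite -!mulrA ler_wpM2l //; apply: le_trans (mx_l1norm_prod_le _ _ _) _.
    rewrite ler_wpM2l // -[m in X in _ <= X * _]card_ord.
    rewrite -prodr_const -big_split.
    apply: ler_prod => i _; rewrite mx_l1norm_ge0 /=.
    by apply: le_trans (mx_l1normM_le _ _) _; rewrite mx_l1normN mulrC.
- move=> e e0.
  have kR : 0 <= k * (2 * mx_l1norm R) by rewrite !mulr_ge0.
  have [N hN] := geometric_small archi kR e0; exists N => m Nm h Bh hlt rbh.
  set T := - h * R; set S := resolvent Y (b + h).
  have T2 : mx_l1norm T <= 2^-1.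
    apply: le_trans (mx_l1normM_le _ _) _; rewrite mx_l1normN.
    by rewrite ltW // hr // mx_l1norm_ge0.
  (* One step of the expansion reads [S = R + S T]; absorb the last term, as [T] is at most 1/2 in
     norm. *)
  have S2 : mx_l1norm S <= 2 * mx_l1norm R.
    have := resolvent_expansion 1 rb rbh.
    rewrite big_ord1 expr0 mulr1 expr1 -/R -/T -/S => SE.
    have : mx_l1norm S <= mx_l1norm R + mx_l1norm S * 2^-1.
      rewrite {1}SE; apply: le_trans (mx_l1normD_le _ _) _; rewrite lerD2l.
      apply: le_trans (mx_l1normM_le _ _) _.
      by rewrite ler_wpM2l // mx_l1norm_ge0.
    rewrite -lerBlDr -{1}[mx_l1norm S]mulr1 -mulrBr.
    have -> : 1 - 2^-1 = 2^-1 :> C by rewrite {1}[1](splitr 1) mul1r addrK.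
    by rewrite ler_pdivrMr // mulrC.
  have -> : fseq_opp (Utrans Y phi) (b + h) - \sum_(k0 < m)
      - map_mx phi (R * \prod_(i < k0) (- h * R)) = - map_mx phi (S * T ^+ m).
    rewrite /fseq_opp /Utrans (resolvent_expansion m rb rbh) -/R -/T -/S.
    rewrite sumrN map_mxD opprD opprK addrAC map_mx_sum.
    under [X in _ + X - _]eq_bigr do rewrite prodr_const card_ord.
    by rewrite addNr add0r.
  rewrite normrN; apply: le_trans (hk _) _; apply: le_trans (ltW (hN m Nm)).
  rewrite -mulrA ler_wpM2l //;
  apply: le_trans (_ : mx_l1norm S * 2^-1 ^+ m <= _).
    have := mx_l1norm_prod_le (index_enum 'I_m) S (fun=> T).
    rewrite !prodr_const card_ord => /le_trans; apply.
    rewrite ler_wpM2l ?mx_l1norm_ge0 //.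
    by rewrite lerXn2r // nnegrE ?mx_l1norm_ge0 ?ltW.
  by rewrite ler_wpM2r // exprn_ge0 // ltW.
Qed.

Lemma Utrans_fully_matricial : fully_matricial B Y (fseq_opp (Utrans Y phi)).
Proof.
split=> [n _|m n b' b'' _ _ rb' rb''|n b S _ rb uS]; rewrite /fseq_opp /Utrans.
- exact: Utrans_analytic.
- have [_ ->] := resolvent_diag hB rb' rb''.
  by rewrite map_block_mx !map_mx0 opp_block_mx !oppr0.
- rewrite (resolvent_similar rb uS) map_scalar_amplr map_scalar_ampll.
  by rewrite mulmxN mulNmx.
Qed.

Lemma dual_positive_of_positive :
  positive_functional phi -> dual_positive B Y (fseq_opp (Utrans Y phi)).
Proof.
move=> pos; have phiE := positive_selfadjoint pos.
split; first exact: Utrans_fully_matricial.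
  move=> n b n0 rb; rewrite /fseq_star /fseq_opp.
  have -> : Utrans Y phi b = Utrans Y (dual_star phi) b by rewrite -phiE.
  rewrite (Utrans_dual_star phi hY n0 rb) /fseq_star.
  by apply/matrixP => i j; rewrite !mxE rmorphN.
move=> n b n0 rb h hh; have [rbs rsE] := resolvent_star hB hY rb.
rewrite nabla_Utrans // rsE; set R := resolvent Y b.
(* The image is hermitian because [phi] equals its dual. The factor [k] makes the quadratic form at
   [v] equal to [phi] of [p *m mxstar p], with the row [p] built from [v], [R] and [k]: a sum of
   terms to which positivity applies. *)
have [k hE] := psdmx_sqrt hh; split.
  apply/matrixP => i j; rewrite mxE [in LHS]mxE [in LHS]mxE [RHS]mxE.
  rewrite [in RHS]phiE /dual_star; congr (_ (phi _)).
  rewrite -mxstarE !mxstarM mxstar_ampl.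
  have [-> _] := hh.
  rewrite -mulmxA; congr ((_ *m _) _ _).
  by apply/matrixP => p q; rewrite !mxstarE starK.
move=> v; rewrite -map_scalar_ampll -map_scalar_amplr mxE.
pose p := ampl E (v^t*) *m R *m ampl E k.
have -> : ampl E (v^t*) *m (R *m ampl E h *m mxstar R) *m ampl E v =
    p *m mxstar p.
  by rewrite /p !mxstarM !mxstar_ampl trmxCK hE amplM !mulmxA.
rewrite mxE raddf_sum; apply: sumr_ge0 => i _.
by rewrite mxstarE -{1}(starK (p 0 i)); exact: pos.
Qed.

End Bound.
End Functional.

(** * Specialization to the complex numbers *)

Lemma complex_archimedean (R : realType) : Num.archimedean_axiom R[i].
Proof.
move=> x; pose a := complex.Re `|x|; exists (Num.bound a).
have xE : `|x| = a%:C.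
  (* A norm in [R[i]] is real, so the bound can be found in [R] and transported back. *)
  by apply/esym/RRe_real/normr_real.
rewrite xE -[_%:R](rmorph_nat (real_complex R)) ltcR.
apply: archi_boundP; rewrite -lecR -xE; exact: normr_ge0.
Qed.

Theorem proposition9p12 (R : realType) (E : cstarAlgType R[i])
    (B : set E) (Y : E)
    (hB : unital_cstar_subalg B) (hY : star Y = Y) (hdense : dense (RA B Y : set (banach E)))
    (d : {linear RA_alg B Y -> tensor (RA_alg B Y) (RA_alg B Y)})
    (hd : GDQ_ring d)
    (hdB : forall b : RA_alg B Y, B (val b) -> d b = 0)
    (hdY : forall y : RA_alg B Y, val y = Y -> d y = tens 1 1)
    (phi : {scalar E}) (hphi : continuous (phi : banach E -> R[i]^o)) :
  [/\ fseq_eq B Y (Utrans Y (dual_star phi)) (fseq_star (Utrans Y phi)),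
      fseq_eq B Y (fseq_star (Utrans Y phi)) (Utrans Y phi) <->
        phi = dual_star phi :> (E -> R[i])
    & positive_functional phi <->
        dual_positive B Y (fseq_opp (Utrans Y phi))].
Proof.
have archi := @complex_archimedean R.
have [c c0 hc] := continuous_scalar_bounded hphi.
split.
- exact: Utrans_dual_star.
- split=> [|phiE].
    exact: (Utrans_selfadjoint_eq hB archi hY hdense c0 hc).
  by move=> n b n0 rb; rewrite -(Utrans_dual_star hB phi hY n0 rb) -phiE.
- split; first exact: (dual_positive_of_positive hB archi hY c0 hc).
  exact: (positive_of_dual_positive hB archi hY hdense c0 hc).
Qed.
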